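(* Let $\mathcal{X}$ be a class of graphs. Then the twin number is bounded in $\mathcal{X}$ if and only if $\mathcal{X}$ is a function of $\mathcal{C}$.
   Context: All graphs are finite and simple; a class of graphs is a set of graphs closed under isomorphism. $\mathcal{C}$ is the class of graphs consisting of one clique together with isolated vertices (equivalently, equivalence graphs with at most one connected component of size more than 1; an equivalence graph is a graph each of whose connected components is complete). Two vertices $a,b$ of a graph are twins if $N(a)\setminus\{b\}=N(b)\setminus\{a\}$; this is an equivalence relation and the twin number of a graph is the number of its equivalence classes. The twin number is bounded in $\mathcal{X}$ if some constant bounds the twin number of every graph in $\mathcal{X}$. For a graph $G$ and distinct vertices $u,w$, $G(u,w)=1$ if they are adjacent and $0$ otherwise. If $G,H_1,\dots,H_k$ are graphs on the same vertex set $V$, $G$ is a (boolean) function of $H_1,\dots,H_k$ if there is a boolean function $f:\{0,1\}^k\to\{0,1\}$ with $G(a,b)=f(H_1(a,b),\dots,H_k(a,b))$ for all distinct $a,b\in V$. A class $\mathcal{Y}$ is a $k$-function of $\mathcal{X}$ if every $G\in\mathcal{Y}$ is a function of at most $k$ graphs from $\mathcal{X}$ (on the vertex set of $G$); $\mathcal{Y}$ is a function of $\mathcal{X}$ if it is a $k$-function for some $k\in\mathbb{N}$. *)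

(* Defs.v *)
From mathcomp Require Import all_boot.

Set Implicit Arguments.
Unset Strict Implicit.
Unset Printing Implicit Defensive.

Record graph (V : finType) := Graph {
  adj : rel V;
  adj_sym : symmetric adj;
  adj_irrefl : irreflexive adj
}.

Definition isomorphic (V W : finType) (G : graph V) (H : graph W) : Prop :=
  exists2 h : V -> W, bijective h & forall u v, adj H (h u) (h v) = adj G u v.

Record graph_class := GraphClass {
  in_class :> forall V : finType, graph V -> Prop;
  in_class_iso : forall (V W : finType) (G : graph V) (H : graph W),
    isomorphic G H -> in_class G -> in_class H
}.

Definition is_clique (V : finType) (G : graph V) (K : {set V}) : Prop :=
  forall u v, u \in K -> v \in K -> u != v -> adj G u v.

Definition is_isolated (V : finType) (G : graph V) (v : V) : Prop :=
  forall u, ~~ adj G v u.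

Definition clique_plus_isolated (V : finType) (G : graph V) : Prop :=
  exists2 K : {set V}, is_clique G K & forall v, v \notin K -> is_isolated G v.

Lemma clique_plus_isolated_iso (V W : finType) (G : graph V) (H : graph W) :
  isomorphic G H -> clique_plus_isolated G -> clique_plus_isolated H.
Proof.
move=> [h [g hK gK] hE] [K cK iK]; exists (g @^-1: K).
  move=> u v; rewrite !inE => uK vK neq_uv.
  rewrite -(gK u) -(gK v) hE; apply: cK => //.
  by rewrite (inj_eq (can_inj gK)).
by move=> v; rewrite inE => vK u; rewrite -(gK v) -(gK u) hE; apply: iK.
Qed.

Definition class_C : graph_class := GraphClass clique_plus_isolated_iso.

Definition neighbours (V : finType) (G : graph V) (v : V) : {set V} :=
  [set u | adj G v u].

Definition twins (V : finType) (G : graph V) : rel V :=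
  fun a b => neighbours G a :\ b == neighbours G b :\ a.

Lemma twinsP (V : finType) (G : graph V) (a b : V) :
  reflect (forall x, x != a -> x != b -> adj G a x = adj G b x) (twins G a b).
Proof.
apply: (iffP eqP) => [/setP eq_ab x xa xb | eq_ab].
  by have := eq_ab x; rewrite !inE xa xb.
apply/setP => x; rewrite !inE.
have [->|xa] := eqVneq x a; first by rewrite adj_irrefl andbF.
have [->|xb] /= := eqVneq x b; first by rewrite adj_irrefl.
exact: eq_ab.
Qed.

Lemma twins_equiv (V : finType) (G : graph V) : equivalence_rel (twins G).
Proof.
have tsym : symmetric (twins G) by move=> a b; rewrite /twins eq_sym.
have ttr : transitive (twins G).
  move=> b a c tab tbc; apply/twinsP => x xa xc.
  have [xb|xb] := eqVneq x b; last first.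
    by rewrite (twinsP _ _ _ tab) // (twinsP _ _ _ tbc).
  have [->//|ac] := eqVneq a c; subst x.
  have ab : a != b by rewrite eq_sym.
  have ca : c != a by rewrite eq_sym.
  have cb : c != b by rewrite eq_sym.
  rewrite [LHS]adj_sym (twinsP _ _ _ tbc a ab ac) [LHS]adj_sym.
  by rewrite (twinsP _ _ _ tab c ca cb) adj_sym.
apply/equivalence_relP; split=> [a|a b tab c]; first by rewrite /twins.
by apply/idP/idP; apply: ttr; rewrite // tsym.
Qed.

Definition twin_number (V : finType) (G : graph V) : nat :=
  #|equivalence_partition (twins G) [set: V]|.

Definition twin_number_bounded (X : graph_class) : Prop :=
  exists c : nat, forall (V : finType) (G : graph V), X V G -> twin_number G <= c.

Definition function_of_graphs (V : finType) (G : graph V) (k : nat)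
    (H : 'I_k -> graph V) : Prop :=
  exists f : {ffun 'I_k -> bool} -> bool,
    forall a b : V, a != b -> adj G a b = f [ffun i => adj (H i) a b].

Definition k_function_of (k : nat) (Y X : graph_class) : Prop :=
  forall (V : finType) (G : graph V), Y V G ->
  exists (j : nat) (H : 'I_j -> graph V),
    [/\ j <= k, forall i, X V (H i) & function_of_graphs G H].

Definition function_of (Y X : graph_class) : Prop :=
  exists k : nat, k_function_of k Y X.

(* Main.v *)
(** If [G] is a function of cliques with vertex sets [K_1, ..., K_j], two
    vertices lying in the same [K_i]'s are twins, so there are at most [2 ^ j]
    twin classes.  Conversely, attach to each pair [(A, B)] of twin classes of
    [G] the clique on [A :|: B]: for distinct [a], [b] the values of these cliques
    at [(a, b)] determine the unordered pair of the twin classes of [a] and [b],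
    and this pair determines whether [a] and [b] are adjacent. *)
From mathcomp Require Import all_boot.
Require Import Defs.

Set Implicit Arguments.
Unset Strict Implicit.
Unset Printing Implicit Defensive.

Lemma leq_card_imset_factor (T S R : finType) (f : T -> R)
    (g : T -> S) (D : {set T}) :
  (forall x y, g x = g y -> f x = f y) -> #|f @: D| <= #|S|.
Proof.
(* [h] recovers [f x] from [g x] through any preimage; it is option-valued because [s] may have no
   preimage and [R] no default element. *)
move=> fg; pose h s := omap f [pick x | g x == s].
rewrite -(card_imset _ (fun _ _ => @Some_inj _ _ _)) -imset_comp.
have -> : (Some \o f) @: D = h @: (g @: D).
  rewrite -imset_comp; apply: eq_imset => x; rewrite /= /h.
  by case: pickP => [y /eqP /fg /= -> //|/(_ x)]; rewrite eqxx.
by apply: leq_trans (leq_imset_card _ _) _; apply: max_card.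
Qed.

Section CliqueGraph.

Variables (V : finType) (K : {set V}).

Definition clique_adj : rel V := fun u v => [&& u != v, u \in K & v \in K].

Lemma clique_adj_sym : symmetric clique_adj.
Proof. by move=> u v; rewrite /clique_adj eq_sym [(u \in K) && _]andbC. Qed.

Lemma clique_adj_irrefl : irreflexive clique_adj.
Proof. by move=> u; rewrite /clique_adj eqxx. Qed.

Definition clique_graph : graph V := Graph clique_adj_sym clique_adj_irrefl.

Lemma clique_graph_in_C : class_C V clique_graph.
Proof.
exists K => [u v uK vK uv|v /negbTE vK u] /=; rewrite /clique_adj.
  by rewrite uv uK vK.
by rewrite vK andbF.
Qed.

End CliqueGraph.

Lemma class_C_adjE (V : finType) (H : graph V) :
  class_C V H ->
  exists K : {set V}, forall u v, adj H u v = [&& u != v, u \in K & v \in K].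
Proof.
move=> [K cK iK]; exists K => u v.
have [<-|uv] /= := eqVneq u v; first exact: adj_irrefl.
have [uK|uK] /= := boolP (u \in K); last exact/negbTE/iK.
have [vK|vK] /= := boolP (v \in K); first exact: cK.
by rewrite adj_sym; apply/negbTE/iK.
Qed.

Section TwinClasses.

Variables (V : finType) (G : graph V).

Definition twin_class (a : V) : {set V} := [set y in [set: V] | twins G a y].

Definition twin_classes := equivalence_partition (twins G) [set: V].

Lemma twin_class_refl a : a \in twin_class a.
Proof. by rewrite !inE /= /twins. Qed.

Lemma twin_class_in a : twin_class a \in twin_classes.
Proof. exact: imset_f. Qed.

Lemma twin_class_eqP a b : reflect (twin_class a = twin_class b) (twins G a b).
Proof.
have /equivalence_relP [rT lT] := twins_equiv G.
apply: (iffP idP) => [tab|E]; first by apply/setP => x; rewrite !inE (lT _ _ tab).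
by have := twin_class_refl b; rewrite -E !inE.
Qed.

Lemma mem_twin_class a b : (b \in twin_class a) = (twin_class a == twin_class b).
Proof. by rewrite !inE; apply/twin_class_eqP/eqP. Qed.

(** The endpoints are replaced one at a time. Twins agree only on third vertices, so every
    intermediate pair must consist of distinct vertices. *)
Lemma adj_twins a b a' b' : a != b -> a' != b' ->
  twin_class a = twin_class a' -> twin_class b = twin_class b' ->
  adj G a b = adj G a' b'.
Proof.
move=> ab ab' Ea Eb.
have move_r x y z : twin_class y = twin_class z -> x != y -> x != z ->
    adj G x y = adj G x z.
  by move=> /twin_class_eqP /twinsP E xy xz; rewrite ![adj G x _]adj_sym E.
have [ba'|ba'] := eqVneq b a'; last first.
  rewrite adj_sym (move_r b a a') //; last by rewrite eq_sym.
  by rewrite adj_sym (move_r a' b b') // eq_sym.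
(* The route through [a'], [b] has collapsed; now [a], [b], [b'] share one twin class, and the route
   goes through [a], [b']. *)
subst a'; have [<-|ab2] := eqVneq a b'; first exact: adj_sym.
rewrite (move_r a b b') // ![adj G _ b']adj_sym.
by rewrite (move_r b' a b) // eq_sym.
Qed.

End TwinClasses.

Lemma twin_number_function_of_C (V : finType) (G : graph V) (k : nat)
    (H : 'I_k -> graph V) :
  (forall i, class_C V (H i)) -> function_of_graphs G H ->
  twin_number G <= 2 ^ k.
Proof.
move=> CH [f fG].
have /fin_all_exists [K HK] i := class_C_adjE (CH i).
pose sig x := [set i | x \in K i].
suff: #|twin_class G @: [set: V]| <= #|{set 'I_k}|.
  by rewrite -cardsT -powersetT card_powerset cardsT card_ord.
apply: (@leq_card_imset_factor _ _ _ _ sig) => x y /setP Exy.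
apply/twin_class_eqP/twinsP => z zx zy.
rewrite !fG 1?eq_sym //; congr f; apply/ffunP => i.
by have := Exy i; rewrite !ffunE !HK !inE [x == z]eq_sym [y == z]eq_sym zx zy => ->.
Qed.

Lemma function_of_twin_class_cliques (V : finType) (G : graph V) :
  function_of_graphs G
    (fun i : 'I_#|setX (twin_classes G) (twin_classes G)| =>
       clique_graph ((enum_val i).1 :|: (enum_val i).2)).
Proof.
set H := fun i => _; set P := setX _ _ in H *.
pose pat a b := [ffun i => adj (H i) a b].
(* With this choice of function, it remains to show that two pairs with the same pattern agree on
   adjacency. *)
exists (fun h => [exists a, exists b, [&& a != b, pat a b == h & adj G a b]]).
move=> a b ab; apply/idP/existsP => [Gab|[a' /existsP [b' /and3P [ab' /eqP E]]]].
  by exists a; apply/existsP; exists b; rewrite ab eqxx Gab.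
have adjH u v x y : x != y -> exists i,
    (adj (H i) x y = [&& (x \in twin_class G u :|: twin_class G v)
                     & (y \in twin_class G u :|: twin_class G v)]) /\
    (u != v -> adj (H i) u v).
  move=> xy; have Puv : (twin_class G u, twin_class G v) \in P.
    by rewrite inE !twin_class_in.
  exists (enum_rank_in Puv (twin_class G u, twin_class G v)).
  rewrite /H /= /clique_adj enum_rankK_in //= xy; split=> // ->.
  by rewrite ![_ \in _ :|: _]in_setU !twin_class_refl orbT.
(* The clique on the classes of [u] and [v] has the edge [uv]; equal patterns make [xy] an edge of
   it too, so both [x] and [y] lie in these classes. *)
have covered u v x y : u != v -> x != y -> pat u v = pat x y ->
    ((twin_class G u == twin_class G x) || (twin_class G v == twin_class G x)) /\
    ((twin_class G u == twin_class G y) || (twin_class G v == twin_class G y)).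
  move=> uv xy /ffunP Euv; have [i [Hi /(_ uv) Hu]] := adjH u v x y xy.
  have := Euv i; rewrite !ffunE Hu Hi => /esym/andP.
  by rewrite ![_ \in _ :|: _]in_setU !mem_twin_class.
have [Ea Eb] := covered _ _ _ _ ab' ab E.
have [Ea' Eb'] := covered _ _ _ _ ab ab' (esym E).
(* Covering in one direction settles all cases except those where [a] and [b] share a class; there
   the reverse covering places the remaining vertex in that class. *)
have [[A B]|[A B]] : (twin_class G a' = twin_class G a /\
    twin_class G b' = twin_class G b) \/
  (twin_class G a' = twin_class G b /\ twin_class G b' = twin_class G a).
- case/orP: Ea => /eqP Ea; case/orP: Eb => /eqP Eb; try by [left|right].
  + by left; split=> //; case/orP: Eb' => /eqP; congruence.
  + by left; split=> //; case/orP: Ea' => /eqP; congruence.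
- by rewrite (adj_twins ab' ab A B).
by rewrite [adj G a b]adj_sym (adj_twins ab' _ A B) // eq_sym.
Qed.

Theorem theorem4p16 (X : graph_class) :
  twin_number_bounded X <-> function_of X class_C.
Proof.
split=> [[c Xc]|[k Xk]].
  (* One clique for each ordered pair of twin classes, of which there are at most [c]. *)
  exists (c * c) => V G XG; eexists; eexists; split; last first.
  - exact: function_of_twin_class_cliques.
  - by move=> i; apply: clique_graph_in_C.
  by rewrite cardsX leq_mul // Xc.
exists (2 ^ k) => V G /Xk [j [H [jk CH fG]]].
by rewrite (leq_trans (twin_number_function_of_C CH fG)) // leq_pexp2l.
Qed.
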